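(* Let $P$ be a graded poset with unique minimal element $\hat0$ and unique maximal element $\hat1$, of rank $r$, whose atoms are labeled by monomials in $\mathbf{k}[x_1,\dots,x_n]$, and let $I_P$ be its poset ideal. Suppose the labeled poset $P$ is complete and that $\widetilde H_i(\Delta(F_{(i+3)}))=0$ for all $0\le i\le r-3$ and all $F\in P$ of rank $\ge i+3$. Then $(\mathcal{C}(P),\partial)$ is a minimal $\mathbb{N}^n$-graded free $\mathbf{k}[\mathbf{x}]$-resolution of $I_P$.
   Context: Labels: for $F\ne\hat0$, $m_F=\mathrm{lcm}\{m_A: A \text{ an atom}, A\le F\}$, and $m_{\hat0}=1$; $I_P$ is generated by the atom labels. $P$ is complete if all $m_F$ are distinct and for every $\mathbf{a}\in\mathbb{N}^n$ the set $\{F\in P:\deg m_F\le\mathbf{a}\}$ has a unique maximal element. For $F\in P$, $\Delta(F)$ is the order complex of $(\hat0,F)$ with $i$-simplices the chains $[F_0,\dots,F_i]$, $F>F_0>\dots>F_i>\hat0$; $C_i(\Delta(F))$ are $\mathbf{k}$-chains ($C_{-1}=\mathbf{k}$ spanned by the empty chain), augmented boundary $\partial[F_0,\dots,F_i]=\sum_j(-1)^j[F_0,\dots,\widehat{F_j},\dots,F_i]$, $\partial[F_0]=\emptyset$; $Z_i(\Delta(F))$ the cycles. For $\mathrm{rk}F-\mathrm{rk}F'=1$, $\phi:Z_i(\Delta(F))\to Z_{i-1}(\Delta(F'))$ maps $[F_0,\dots,F_i]$ to $[F_1,\dots,F_i]$ if $F_0=F'$ and to $0$ otherwise; for atoms $A$,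 $\phi$ maps the empty chain of $Z_{-1}(\Delta(A))$ to $1\in\mathbf{k}$ (the term for $\hat0$). $F_{(j)}$ is the lower interval $[\hat0,F]$ with all elements of rank $\ge j$ removed, and $\Delta(F_{(j)})$ is the order complex of the proper part of $F_{(j)}\cup\{F\}$. $\langle m_F\rangle$ is the free rank-one $\mathbb{N}^n$-graded module generated in degree $\deg m_F$. $\mathcal{C}(P)=\bigoplus_{F\in P}Z_{\mathrm{rk}(F)-2}(\Delta(F))\otimes_\mathbf{k}\langle m_F\rangle$, where the summand of $F$ sits in homological degree $\mathrm{rk}(F)-1$ and the summand for $F=\hat0$ is $\mathbf{k}\otimes\langle 1\rangle=\mathbf{k}[\mathbf{x}]$ in degree $-1$; the differential is $\partial=\phi\otimes(\text{inclusion }\langle m_F\rangle\to\langle m_{F'}\rangle)$. ''Minimal free resolution of $I_P$'' means: the part in homological degrees $\ge0$ is exact, the image of the degree-$0$ part in $\mathbf{k}[\mathbf{x}]$ is $I_P$, and the resolution is minimal. *)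

(* Defs.v *)
From HB Require Import structures.
From mathcomp Require Import all_boot all_order all_algebra.
From mathcomp Require Import mpoly.

Set Implicit Arguments.
Unset Strict Implicit.
Unset Printing Implicit Defensive.

Import Order.TTheory GRing.Theory.
Local Open Scope ring_scope.

Section OrderComplex.
Variables (disp : Order.disp_t) (P : finPOrderType disp).
Implicit Types V : {set P}.

(* Simplices are indexed by their number s of vertices: s.-tuples are the
   (s-1)-simplices [F_0, ..., F_(s-1)], F_0 > ... > F_(s-1), and the unique
   0-tuple is the empty simplex, of dimension -1. *)
Definition is_simplex V (s : nat) (t : s.-tuple P) : bool :=
  sorted >%O t && all (mem V) t.

Definition face (s : nat) (u : s.-tuple P) (j : 'I_s) : s.-1.-tuple P :=
  [tuple tnth u (lift j i) | i < s.-1].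

Section Coefficients.
Variable R : comNzRingType.

Definition basis_chain (s : nat) (t : s.-tuple P) : {ffun s.-tuple P -> R^o} :=
  [ffun u => (u == t)%:R].

Definition is_chain V (s : nat) (c : {ffun s.-tuple P -> R^o}) : Prop :=
  forall t, c t != 0 -> is_simplex V t.

(* Augmented boundary; it is 0 for s = 0. *)
Definition boundary (s : nat) (c : {ffun s.-tuple P -> R^o}) :
    {ffun s.-1.-tuple P -> R^o} :=
  \sum_(u : s.-tuple P)
     c u *: (\sum_(j < s) (-1) ^+ j *: basis_chain (face u j)).

(* The elements of Z_(s-1). *)
Definition is_cycle V (s : nat) (c : {ffun s.-tuple P -> R^o}) : Prop :=
  is_chain V c /\ boundary c = 0.

(* Reduced homology with coefficients in R of the order complex of V,
   in dimension i >= 0. *)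
Definition reduced_homology_vanishes V (i : nat) : Prop :=
  forall z : {ffun i.+1.-tuple P -> R^o}, is_cycle V z ->
  exists2 c : {ffun i.+2.-tuple P -> R^o}, is_chain V c & boundary c = z.

(* Defined for every coefficient ring R: over k this is phi, and over
   R = k[x] it is phi (x) id_(k[x]). *)
Definition phi (F' : P) (s : nat) (c : {ffun s.+1.-tuple P -> R^o}) :
    {ffun s.-tuple P -> R^o} :=
  \sum_(u : s.+1.-tuple P)
     c u *: (if thead u == F' then basis_chain [tuple of behead u] else 0).

End Coefficients.
End OrderComplex.

Section LabeledPoset.
Variables (disp : Order.disp_t) (P : finTBPOrderType disp).

Definition covered (F G : P) : bool :=
  (F < G)%O && [forall H, ~~ ((F < H)%O && (H < G)%O)].

Definition atom (A : P) : bool := covered \bot%O A.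

Definition is_rank_function (rk : P -> nat) : Prop :=
  rk \bot%O = 0%N /\ forall F G, covered F G -> rk G = (rk F).+1.

(* Vertex set of Delta(F). *)
Definition open_below (F : P) : {set P} := [set G | (\bot < G)%O && (G < F)%O].

(* F_(j) *)
Definition truncation (rk : P -> nat) (F : P) (j : nat) : {set P} :=
  [set G | (G <= F)%O && (rk G < j)%N].

(* Vertex set of Delta(F_(j)): F_(j) together with F is bounded by \bot and F. *)
Definition truncation_proper_part (rk : P -> nat) (F : P) (j : nat) : {set P} :=
  (F |: truncation rk F j) :\: [set \bot%O; F].

Variables (n : nat) (lab : {A : P | atom A} -> 'X_{1..n}).

(* m_F as an exponent vector; no atom lies below \bot, so m_\bot = 1. *)
Definition label (F : P) : 'X_{1..n} :=
  \big[@mlcm n/0%MM]_(A : {A : P | atom A} | (val A <= F)%O) lab A.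

Definition maximal_below_degree (a : 'X_{1..n}) (F : P) : Prop :=
  (label F <= a)%MM /\
  forall G, (label G <= a)%MM -> (F <= G)%O -> G = F.

Definition complete : Prop :=
  injective label /\
  forall a : 'X_{1..n}, exists! F, maximal_below_degree a F.

(* I_P *)
Definition poset_ideal (k : fieldType) (p : {mpoly k[n]}) : Prop :=
  exists q : {A : P | atom A} -> {mpoly k[n]}, p = \sum_A q A * 'X_[lab A].

End LabeledPoset.

Section GradedModules.
Variables (k : fieldType) (n : nat).
Notation S := {mpoly k[n]}.

(* An N^n-graded k[x]-module, given as the submodule gmem of an ambient
   k[x]-module together with its homogeneous components gcomp a. The module
   axioms are not fields of the record: they follow from graded_free. *)
Record gmodule := GModule {
  gambient :> lmodType S;
  gmem : gambient -> Prop;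
  gcomp : 'X_{1..n} -> gambient -> Prop }.

Definition homogeneous_of_degree (a : 'X_{1..n}) (p : S) : Prop :=
  forall b, b \in msupp p -> b = a.

Definition gring : gmodule :=
  @GModule (S^o : lmodType S) (fun=> True) homogeneous_of_degree.

(* A finite homogeneous basis b with degrees e: gmem is freely generated by b,
   and gcomp a consists of the combinations whose i-th coefficient is
   homogeneous of degree a - e i (hence is 0 unless e i <= a). *)
Definition graded_free (M : gmodule) : Prop :=
  exists (N : nat) (b : 'I_N -> M) (e : 'I_N -> 'X_{1..n}),
  [/\ forall v, gmem v <-> exists p : 'I_N -> S, v = \sum_i p i *: b i,
      forall p : 'I_N -> S, \sum_i p i *: b i = 0 -> forall i, p i = 0
    & forall a v, gcomp a v <->
        exists2 p : 'I_N -> S,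
          forall i c, c \in msupp (p i) -> (e i + c)%MM = a
        & v = \sum_i p i *: b i].

Definition graded_hom (M N : gmodule) (f : M -> N) : Prop :=
  [/\ forall v, gmem v -> gmem (f v),
      forall (p : S) v w, gmem v -> gmem w -> f (p *: v + w) = p *: f v + f w
    & forall a v, gcomp a v -> gcomp a (f v)].

(* (x_1, ..., x_n) M *)
Definition in_maximal_ideal_mul (M : gmodule) (v : M) : Prop :=
  exists2 w : 'I_n -> M, forall i, gmem (w i) & v = \sum_i ('X_i : S) *: w i.

Definition minimal_graded_free_resolution (C : nat -> gmodule)
    (del : forall d, C d.+1 -> C d) (aug : C 0%N -> gring) (I : S -> Prop) :
    Prop :=
  [/\ (forall d, graded_free (C d)),
      (forall d, graded_hom (del d)) /\ graded_hom aug,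
      (forall d (v : C d.+1), gmem v ->
         (del d v = 0 <-> exists2 w : C d.+2, gmem w & del d.+1 w = v)) /\
      (forall v : C 0%N, gmem v ->
         (aug v = 0 <-> exists2 w : C 1%N, gmem w & del 0%N w = v)),
      (forall p : S, I p <-> exists2 v : C 0%N, gmem v & aug v = p)
    & (forall d (v : C d.+1), gmem v -> in_maximal_ideal_mul (del d v))].

(* For a subspace Z of k^T, the subspace Z (x)_k <m> of
   k^T (x)_k k[x] = k[x]^T, where <m> is the principal ideal generated by the
   monomial x^m: finite sums of pure tensors z (x) q x^m. *)
Definition tensor_monomial (T : finType) (Z : {ffun T -> k^o} -> Prop)
    (m : 'X_{1..n}) (c : {ffun T -> S^o}) : Prop :=
  exists (N : nat) (z : 'I_N -> {ffun T -> k^o}) (q : 'I_N -> S),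
    (forall j, Z (z j)) /\
    c = \sum_j [ffun t => (z j t)%:MP * (q j * 'X_[m])].

End GradedModules.

Section PosetComplex.
Variables (k : fieldType) (n : nat).
Variables (disp : Order.disp_t) (P : finTBPOrderType disp).
Variables (rk : P -> nat) (lab : {A : P | atom A} -> 'X_{1..n}).
Notation S := {mpoly k[n]}.

(* Homological degree d >= 0 of C(P). The summand of F is nonzero only for
   rk F = d + 1, where Z_(rk F - 2) lives on chains with d elements. *)
Definition poset_chain (d : nat) : lmodType S :=
  {ffun P -> {ffun d.-tuple P -> S^o}}.

Definition poset_mem (d : nat) (c : poset_chain d) : Prop :=
  forall F : P,
    if rk F == d.+1 then
      tensor_monomial (@is_cycle _ P k (open_below F) d) (label lab F) (c F)
    else c F = 0.

(* The degree a part, for the grading that k^T (x) <m_F> inherits from k[x]. *)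
Definition poset_comp (d : nat) (a : 'X_{1..n}) (c : poset_chain d) : Prop :=
  poset_mem c /\ forall F t, homogeneous_of_degree a (c F t : S).

Definition poset_module (d : nat) : gmodule k n :=
  GModule (@poset_mem d) (@poset_comp d).

Definition poset_del (d : nat) (c : poset_module d.+1) : poset_module d :=
  [ffun F' : P => \sum_(F : P | rk F == (rk F').+1) phi F' (c F)].

(* The differential onto the summand k[x] of \bot, in degree -1. *)
Definition poset_aug (c : poset_module 0) : gring k n :=
  \sum_(A : P | atom A) c A [tuple].

End PosetComplex.

(* Main.v *)
Require Import Defs.
From HB Require Import structures.
From mathcomp Require Import all_boot all_order all_algebra.
From mathcomp Require Import mpoly.
From mathcomp Require Import zify.

Set Implicit Arguments.
Unset Strict Implicit.
Unset Printing Implicit Defensive.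

Import Order.TTheory GRing.Theory.

(** Fix an exponent [a]. By completeness the elements whose label divides [x^a]
    form a lower interval [[\bot, G]], and the degree-[a] strand of C(P) is the
    sum of the cycle spaces Z_(d-1)(Delta(F)) over [F <= G] of rank [d + 1].
    Coning each cycle with its [F] identifies this strand with the chains
    on saturated flags [F_0 > ... > F_d] of ranks [d + 1, ..., 1] whose boundary
    has no term of top rank, and turns the differential into the simplicial
    boundary. A cycle of the strand is thus a [d]-cycle of the elements of rank
    at most [d + 1] below [G]; it bounds among the elements of rank at most
    [d + 2], by the homology hypothesis if [rk G >= d + 3], by coning with [G]
    if [rk G = d + 2], and because it vanishes if [rk G <= d + 1]. Minimality
    holds because distinct labels make [m_F'] a proper divisor of [m_F] for
    [F' < F]. *)

(** * Chains on tuples and the augmented boundary *)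

Section OrderComplexTheory.
Local Open Scope ring_scope.
Variables (disp : Order.disp_t) (P : finPOrderType disp).

Lemma big_tuple_cons (T : finType) (V : nmodType) (s : nat)
    (f : s.+1.-tuple T -> V) :
  \sum_u f u = \sum_x \sum_(t : s.-tuple T) f [tuple of x :: t].
Proof.
rewrite pair_big /=.
rewrite (reindex (fun p : T * s.-tuple T => [tuple of p.1 :: p.2])) //=.
exists (fun u => (thead u, [tuple of behead u])) => [[x t] _|u _].
  by congr pair; apply: val_inj.
by rewrite [RHS]tuple_eta.
Qed.

Lemma cons_tuple_eqE (T : eqType) (s : nat) (x y : T) (t u : s.-tuple T) :
  ([tuple of x :: t] == [tuple of y :: u]) = (x == y) && (t == u).
Proof. by rewrite -!val_eqE /= eqseq_cons. Qed.

Section Coefficients.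
Variable R : comNzRingType.
Implicit Types (F G : P).

(** Prepending [F] is injective, so a single tuple contributes to the coefficient of [t]. *)
Lemma phiE F s (c : {ffun s.+1.-tuple P -> R^o}) (t : s.-tuple P) :
  phi F c t = c [tuple of F :: t].
Proof.
have beh G (u : s.-tuple P) : [tuple of behead [tuple of G :: u]] = u.
  exact: val_inj.
rewrite /phi sum_ffunE big_tuple_cons (bigD1 F) //= [X in _ + X]big1 ?addr0.
  rewrite (bigD1 t) //= big1 ?addr0 => [|u nu]; rewrite !ffunE theadE eqxx beh.
    by rewrite ffunE eqxx; apply: mulr1.
  by rewrite ffunE [t == u]eq_sym (negPf nu) scaler0.
move=> G nG; apply: big1 => u _.
by rewrite !ffunE theadE (negPf nG) ffunE scaler0.
Qed.

Lemma phi0 F s : phi F (0 : {ffun s.+1.-tuple P -> R^o}) = 0.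
Proof. by apply/ffunP => t; rewrite phiE !ffunE. Qed.

Lemma boundaryE s (c : {ffun s.-tuple P -> R^o}) t :
  boundary c t = \sum_u c u * \sum_(j < s) (-1) ^+ j * (t == face u j)%:R.
Proof.
rewrite /boundary sum_ffunE; apply: eq_bigr => u _; rewrite ffunE sum_ffunE.
congr (_ * _); apply: eq_bigr => j _; rewrite !ffunE; exact: erefl.
Qed.

Lemma boundary_linear s : linear (@boundary _ P R s).
Proof.
move=> a c c'; apply/ffunP => t; rewrite !ffunE !boundaryE.
rewrite scaler_sumr -big_split; apply: eq_bigr => u _ /=.
by rewrite !ffunE mulrDl -scalerAl.
Qed.
HB.instance Definition _ s := GRing.isLinear.Build R _ _ _ (@boundary _ P R s)
  (@boundary_linear s).

Lemma boundary_empty (c : {ffun 0.-tuple P -> R^o}) : boundary c = 0.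
Proof.
by apply/ffunP => t; rewrite boundaryE ffunE big1 // => u _;
  rewrite big_ord0 mulr0.
Qed.

(** The augmentation, which [boundary_cons] leaves out because its target tuples are nonempty. *)
Lemma boundary_point (c : {ffun 1.-tuple P -> R^o}) t :
  boundary c t = \sum_G c [tuple of G :: t].
Proof.
rewrite boundaryE big_tuple_cons; apply: eq_bigr => G _.
have eq0 (u v : 0.-tuple P) : u = v by rewrite (tuple0 u) (tuple0 v).
rewrite (bigD1 t) //= [X in _ + X]big1 ?addr0 => [|u]; last first.
  by rewrite (eq0 u t) eqxx.
rewrite big_ord_recl big_ord0 addr0 mul1r (_ : t == _) ?mulr1 //.
by apply/eqP/eq0.
Qed.

(* Splits the boundary according to whether the first vertex is removed. *)
Lemma boundary_cons s (c : {ffun s.+2.-tuple P -> R^o}) F (t : s.-tuple P) :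
  boundary c [tuple of F :: t]
    = \sum_G c [tuple of G :: [tuple of F :: t]] - boundary (phi F c) t.
Proof.
have face0 G (u : s.+1.-tuple P) : face [tuple of G :: u] ord0 = u.
  by apply: eq_from_tnth => i; rewrite tnth_mktuple tnthS.
have faceS G (u : s.+1.-tuple P) j :
    face [tuple of G :: u] (lift ord0 j) = [tuple of G :: face u j].
  apply: eq_from_tnth => i; rewrite tnth_mktuple.
  case: (unliftP ord0 i) => [i'|] -> /=; last first.
    by rewrite tnth0 (_ : lift _ _ = ord0) ?tnth0 //; apply: val_inj.
  rewrite tnthS tnth_mktuple.
  rewrite (_ : lift (lift ord0 j) _ = lift ord0 (lift j i')) ?tnthS //.
  by apply: val_inj; rewrite /= /bump /= !add1n ltnS addnS.
rewrite boundaryE big_tuple_cons.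
under eq_bigr do under eq_bigr do rewrite big_ord_recl mulrDr expr0 mul1r face0.
under eq_bigr do rewrite big_split /=.
rewrite big_split /=; congr (_ + _).
  apply: eq_bigr => G _; rewrite (bigD1 [tuple of F :: t]) //= eqxx mulr1.
  by rewrite big1 ?addr0 // => u nu; rewrite [_ == u]eq_sym (negPf nu) mulr0.
rewrite (bigD1 F) //= [X in _ + X]big1 ?addr0 => [|G nG]; last first.
  apply: big1 => u _; rewrite big1 ?mulr0 // => j _.
  by rewrite faceS cons_tuple_eqE [F == G]eq_sym (negPf nG) mulr0.
rewrite [in RHS](boundaryE (phi F c) t) -sumrN; apply: eq_bigr => u _.
rewrite phiE -mulrN -sumrN; congr (_ * _); apply: eq_bigr => j _.
by rewrite faceS cons_tuple_eqE eqxx /bump /= exprS mulN1r mulNr.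
Qed.

Lemma is_chain0 (V : {set P}) s : is_chain V (0 : {ffun s.-tuple P -> R^o}).
Proof. by move=> t; rewrite ffunE eqxx. Qed.

Lemma is_cycle0 (V : {set P}) s : is_cycle V (0 : {ffun s.-tuple P -> R^o}).
Proof. by split; [apply: is_chain0 | rewrite linear0]. Qed.

Lemma is_cycle_linear (V : {set P}) s a (c c' : {ffun s.-tuple P -> R^o}) :
  is_cycle V c -> is_cycle V c' -> is_cycle V (a *: c + c').
Proof.
move=> [cV c0] [cV' c0']; split; last first.
  by rewrite boundary_linear c0 c0' scaler0 addr0.
move=> t; rewrite !ffunE; have [e|/cV //] := eqVneq (c t) 0.
by rewrite e scaler0 add0r => /cV'.
Qed.

End Coefficients.
End OrderComplexTheory.

(** * Rank functions and ranks along chains *)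

Section RankedPoset.
Variables (disp : Order.disp_t) (P : finTBPOrderType disp) (rk : P -> nat).
Hypothesis rk_graded : is_rank_function rk.

(** Induction on the number of elements strictly between: if [G] does not cover [F], an intermediate
    element leaves two intervals with fewer elements. *)
Lemma rk_lt (F G : P) : (F < G)%O -> rk F < rk G.
Proof.
have [m] := ubnP #|[set H | (F < H < G)%O]|.
elim: m F G => // m IH F G; rewrite ltnS => le_m ltFG.
have [cov|] := boolP (covered F G); first by rewrite (rk_graded.2 F G).
rewrite /covered ltFG /= => /forallPn[H]; rewrite negbK => /andP[ltFH ltHG].
apply: (@ltn_trans (rk H)); apply: IH => //.
  apply: leq_trans le_m; apply: proper_card; apply/properP; split.
    apply/subsetP => K; rewrite !inE => /andP[-> ltKH] /=.
    exact: lt_trans ltKH ltHG.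
  by exists H; rewrite !inE ?ltFH ?ltHG // ltxx andbF.
apply: leq_trans le_m; apply: proper_card; apply/properP; split.
  apply/subsetP => K; rewrite !inE => /andP[ltHK ->]; rewrite andbT.
  exact: lt_trans ltFH ltHK.
by exists H; rewrite !inE ?ltFH ?ltHG // ltxx.
Qed.

Lemma rk_le (F G : P) : (F <= G)%O -> rk F <= rk G.
Proof. by rewrite le_eqVlt => /orP[/eqP->//|/rk_lt/ltnW]. Qed.

Lemma rk_gt0 (F : P) : (0 < rk F) = (\bot < F)%O.
Proof.
have [->|nF] := eqVneq F \bot%O; first by rewrite rk_graded.1 ltxx.
have lt0F : (\bot < F)%O by rewrite lt0x.
by rewrite lt0F -rk_graded.1 rk_lt.
Qed.

Lemma atom_rk (F : P) : atom F = (rk F == 1).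
Proof.
apply/idP/eqP => [/rk_graded.2->|rkF]; first by rewrite rk_graded.1.
rewrite /atom /covered -rk_gt0 rkF /=; apply/forallP => H; apply/negP.
by rewrite -rk_gt0 => /andP[H0 /rk_lt]; rewrite rkF ltnNge H0.
Qed.

Lemma simplex_consE (V : {set P}) s F (t : s.-tuple P) :
  is_simplex V [tuple of F :: t]
    = [&& F \in V, all (fun G => G < F)%O t & is_simplex V t].
Proof.
rewrite /is_simplex /= (path_sortedE (rev_trans lt_trans)).
by rewrite -!andbA; do !bool_congr.
Qed.

Lemma simplex_open_belowE s F (t : s.-tuple P) :
  is_simplex (open_below F) t =
  [&& sorted >%O t, all (fun G => \bot < G)%O t & all (fun G => G < F)%O t].
Proof.
rewrite /is_simplex -all_predI; congr (_ && _); apply: eq_all => G.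
by rewrite /= inE.
Qed.

Lemma simplex_open_below_cons s F F' (t : s.-tuple P) :
  is_simplex (open_below F) [tuple of F' :: t] ->
  (\bot < F' < F)%O /\ is_simplex (open_below F') t.
Proof.
rewrite simplex_consE inE => /and3P[/andP[-> ->]] ltt.
by rewrite !simplex_open_belowE => /and3P[-> -> _]; rewrite ltt.
Qed.

(** Ranks drop strictly along a chain and stay positive above [\bot]. This forces chains of maximal
    length to be saturated. *)
Lemma simplex_rk s F (t : s.-tuple P) :
  (\bot < F)%O -> is_simplex (open_below F) t -> s < rk F.
Proof.
elim: s F t => [|s IH] F t; first by rewrite rk_gt0.
case/tupleP: t => F' t _ /simplex_open_below_cons[/andP[lt0 /rk_lt ltF']].
by move=> /(IH _ _ lt0)/leq_ltn_trans; apply.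
Qed.

(** * Exactness of a single strand *)

Section LocalComplex.
Local Open Scope ring_scope.
Variables (R : comNzRingType) (G : P).

(* The strand of C(P) in a degree a for which G is the largest element whose
   label divides x^a. *)
Definition local_mem d (x : P -> {ffun d.-tuple P -> R^o}) : Prop :=
  forall F, if (rk F == d.+1) && (F <= G)%O
            then is_cycle (open_below F) (x F) else x F = 0.

Definition local_del d (x : P -> {ffun d.+1.-tuple P -> R^o}) (F' : P) :
    {ffun d.-tuple P -> R^o} :=
  \sum_(F | rk F == (rk F').+1) phi F' (x F).

Lemma local_mem_supp d (x : P -> {ffun d.-tuple P -> R^o}) F t :
  local_mem x -> x F t != 0 ->
  [/\ rk F = d.+1, (F <= G)%O & is_simplex (open_below F) t].
Proof.
move=> /(_ F); case: andP => [[/eqP-> ->] [cF _] /cF //|_ ->].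
by rewrite ffunE eqxx.
Qed.

Lemma local_mem_boundary d (x : P -> {ffun d.-tuple P -> R^o}) F :
  local_mem x -> boundary (x F) = 0.
Proof. by move=> /(_ F); case: ifP => [_ []|_ ->] //; rewrite linear0. Qed.

(** The rank of [F'] is squeezed: it is less than that of [F], and [d] further elements lie between
    [F'] and [\bot]. *)
Lemma local_mem_supp_cons d (x : P -> {ffun d.+1.-tuple P -> R^o}) F F'
    (t : d.-tuple P) :
  local_mem x -> x F [tuple of F' :: t] != 0 ->
  [/\ rk F = d.+2, (F <= G)%O, (F' < F)%O, rk F' = d.+1
    & is_simplex (open_below F') t].
Proof.
move=> xm /(local_mem_supp xm)[rkF leF].
case/simplex_open_below_cons=> /andP[lt0 ltF].
move=> st; split=> //; apply/eqP; rewrite eqn_leq (simplex_rk lt0 st) andbT.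
by rewrite -ltnS -rkF rk_lt.
Qed.

(** Ranks are forced by length, so the rank condition on [F] holds wherever [x F] contributes, and
    the differential is a contraction of the total chain. *)
Lemma local_delE d (x : P -> {ffun d.+1.-tuple P -> R^o}) F' :
  local_mem x -> local_del x F' = phi F' (\sum_F x F).
Proof.
move=> xm; apply/ffunP => t; rewrite phiE !sum_ffunE big_mkcond /=.
apply: eq_bigr => F _; case: ifP => [_|rkF]; first by rewrite phiE.
apply/esym/eqP; apply: contraFT rkF => /(local_mem_supp_cons xm)[-> _ _ -> _].
by rewrite eqxx.
Qed.

Lemma local_total_boundary d (x : P -> {ffun d.-tuple P -> R^o}) :
  local_mem x -> boundary (\sum_F x F) = 0.
Proof.
by move=> xm; rewrite linear_sum big1 // => F _; apply: local_mem_boundary.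
Qed.

Lemma local_total_supp d (x : P -> {ffun d.+1.-tuple P -> R^o}) F'
    (t : d.-tuple P) :
  local_mem x -> (\sum_F x F) [tuple of F' :: t] != 0 ->
  [/\ rk F' = d.+1, (F' <= G)%O & is_simplex (open_below F') t].
Proof.
move=> xm; rewrite sum_ffunE => nz.
have [F] : exists F, x F [tuple of F' :: t] != 0.
  apply/existsP; apply: contraNT nz => /existsPn z.
  by rewrite big1 // => F _; apply/eqP; have := z F; rewrite negbK.
case/(local_mem_supp_cons xm) => _ leF ltF -> st.
by rewrite (le_trans (ltW ltF) leF).
Qed.

(** Apply [boundary_cons] to the total cycle: no chain contains two elements of equal rank, so the
    contraction at [F] is itself a cycle. *)
Lemma local_del_mem d (x : P -> {ffun d.+1.-tuple P -> R^o}) :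
  local_mem x -> local_mem (local_del x).
Proof.
move=> xm F; rewrite local_delE //; case: ifP => [/andP[/eqP rkF leF]|nF].
  split=> [t|]; first by rewrite phiE => /(local_total_supp xm)[].
  case: d x xm rkF => [|d] x xm rkF; first by rewrite boundary_empty.
  apply/ffunP => t; have := boundary_cons (\sum_F x F) F t.
  rewrite local_total_boundary // ffunE big1 => [|H _].
    by move/esym/eqP; rewrite add0r oppr_eq0 ffunE => /eqP.
  apply/eqP; apply: contraT => /(local_total_supp xm)[rkH _].
  by case/simplex_open_below_cons=> /andP[_ /rk_lt]; rewrite rkF rkH ltnn.
apply/ffunP => t; rewrite phiE [RHS]ffunE; apply/eqP.
by apply: contraFT nF => /(local_total_supp xm)[-> -> _]; rewrite eqxx.
Qed.

(** In [boundary_cons] for the total cycle the contracted term vanishes as well, leaving the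
    required sum. In terms of totals, the square-zero relation and its augmented version take one
    form. *)
Lemma local_total_del d (x : P -> {ffun d.+1.-tuple P -> R^o}) :
  local_mem x -> \sum_F local_del x F = 0.
Proof.
move=> xm; have dm := local_del_mem xm; apply/ffunP => t.
rewrite sum_ffunE [RHS]ffunE.
under eq_bigr do rewrite local_delE // phiE.
have bx := local_total_boundary xm.
case: d x xm dm t bx => [|d] x xm dm t bx.
  by rewrite -boundary_point bx ffunE.
case/tupleP: t => F u.
have := boundary_cons (\sum_F x F) F u; rewrite bx ffunE -local_delE //.
by rewrite local_mem_boundary // ffunE subr0.
Qed.

(** A chain on nonempty tuples is determined by its contractions. Kernels in positive degree thus
    become the same condition, total zero, as the kernel of the augmentation. *)
Lemma local_del_total0 d (x : P -> {ffun d.+1.-tuple P -> R^o}) :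
  local_mem x -> (forall F, local_del x F = 0) <-> \sum_F x F = 0.
Proof.
move=> xm; split=> [x0|x0 F]; last by rewrite local_delE // x0 phi0.
apply/ffunP => t; case/tupleP: t => F t.
by have /ffunP/(_ t) := x0 F; rewrite local_delE // phiE !ffunE.
Qed.

(* The sum over F of the cones [F, x_F]. *)
Definition total_chain d (x : P -> {ffun d.-tuple P -> R^o}) :
    {ffun d.+1.-tuple P -> R^o} :=
  [ffun u => x (thead u) [tuple of behead u]].

Lemma total_chain_cons d (x : P -> {ffun d.-tuple P -> R^o}) F
    (t : d.-tuple P) :
  total_chain x [tuple of F :: t] = x F t.
Proof. by rewrite ffunE theadE; congr (x F _); apply: val_inj. Qed.

(** By [boundary_cons], removing the apex contributes [\sum_F x F], and removing a later vertex
    contributes the boundary of the cycle [x F]. *)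
Lemma total_chain_boundary d (x : P -> {ffun d.-tuple P -> R^o}) :
  local_mem x -> \sum_F x F = 0 -> boundary (total_chain x) = 0.
Proof.
case: d x => [|d] x xm x0; apply/ffunP => t.
  rewrite boundary_point; under eq_bigr do rewrite total_chain_cons.
  by rewrite -sum_ffunE x0.
case/tupleP: t => F u.
rewrite boundary_cons; under eq_bigr do rewrite total_chain_cons.
rewrite -sum_ffunE x0 [in LHS]ffunE (_ : phi F _ = x F).
  by rewrite local_mem_boundary // !ffunE subr0.
by apply/ffunP => v; rewrite phiE total_chain_cons.
Qed.

Lemma local_exact d (x : P -> {ffun d.-tuple P -> R^o}) :
  ((d + 3 <= rk G)%N ->
     reduced_homology_vanishes R (truncation_proper_part rk G (d + 3)) d) ->
  local_mem x -> \sum_F x F = 0 ->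
  exists2 w : P -> {ffun d.+1.-tuple P -> R^o},
    local_mem w & forall F, local_del w F = x F.
Proof.
move=> homG xm x0; have bx := total_chain_boundary xm x0.
have [le3|] := leqP (d + 3) (rk G); last rewrite addn3 ltnS leq_eqVlt.
(* Here [G] itself exceeds the rank bound, so the vertices are the elements other than [\bot] below
   [G] of rank at most [d + 2]. *)
- have memV F : (F \in truncation_proper_part rk G (d + 3)) =
      [&& (\bot < F)%O, (F <= G)%O & (rk F < d + 3)%N].
    rewrite !inE negb_or lt0x; case: eqP => //= _.
    by case: eqP => //= ->; rewrite lexx ltnNge le3.
  have [|y yV yx] := homG le3 (total_chain x).
    split=> // u; case/tupleP: u => F t.
    rewrite total_chain_cons => /(local_mem_supp xm)[rkF leF].
    rewrite simplex_open_belowE simplex_consE memV leF rkF -rk_gt0 rkF /=.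
    have -> : (d.+1 < d + 3)%N by rewrite addn3.
    case/and3P=> st /allP t0 tF; rewrite tF; move/allP: tF => tF.
    rewrite /is_simplex st; apply/allP => H tH /=; rewrite memV t0 //=.
    rewrite (le_trans (ltW (tF _ tH)) leF) /=.
    by apply: leq_trans (rk_lt (tF _ tH)) _; rewrite rkF addn3 ltnW.
  (* With [d + 2] vertices of rank between [1] and [d + 2], every simplex in [y] is a saturated
     flag. *)
  have ysupp F (t : d.+1.-tuple P) : y [tuple of F :: t] != 0 ->
      [/\ rk F = d.+2, (F <= G)%O & is_simplex (open_below F) t].
    move=> /yV; rewrite simplex_consE memV => /and3P[/and3P[F0 -> rkF] tF].
    rewrite /is_simplex => /andP[st /allP tV].
    have sF : is_simplex (open_below F) t.
      rewrite simplex_open_belowE st tF andbT; apply/allP => H /tV /=.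
      by rewrite memV => /andP[].
    split=> //; apply/eqP; rewrite eqn_leq (simplex_rk F0 sF) andbT.
    by rewrite -ltnS -addn3.
  have wm : local_mem (fun F => phi F y).
    move=> F; case: ifP => [/andP[/eqP rkF leF]|nF].
      split=> [t|]; first by rewrite phiE => /ysupp[].
      (* The boundary of [y] has no term starting in rank [d + 2], and no chain has two elements of
         that rank, so the contraction is a cycle. *)
      apply/ffunP => t; have := boundary_cons y F t.
      rewrite yx total_chain_cons.
      have -> : x F t = 0.
        apply/eqP; apply: contraT => /(local_mem_supp xm)[].
        by rewrite rkF => /eqP; rewrite eqn_leq ltnn.
      rewrite big1 => [|H _].
        by move/esym/eqP; rewrite add0r oppr_eq0 ffunE => /eqP.
      apply/eqP; apply: contraT => /ysupp[rkH _].
      by case/simplex_open_below_cons=> /andP[_ /rk_lt]; rewrite rkF rkH ltnn.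
    apply/ffunP => t; rewrite phiE [RHS]ffunE; apply/eqP.
    by apply: contraFT nF => /ysupp[-> -> _]; rewrite eqxx.
  (* Since each contraction of [y] is a cycle, only removal of the top vertex survives in the
     boundary of [y], which is [total_chain x]. *)
  exists (fun F => phi F y) => // F; rewrite local_delE //; apply/ffunP => t.
  rewrite phiE sum_ffunE; under eq_bigr do rewrite phiE.
  have := boundary_cons y F t; rewrite yx total_chain_cons => ->.
  by rewrite (local_mem_boundary _ wm) ffunE subr0.
- case/orP => [/eqP [rkG]|rkG].
    (* If [rk G = d + 2], the cones form a cycle strictly below [G], which can be placed in the
       summand of [G]. *)
    have wm : local_mem (fun F => if F == G then total_chain x else 0).
      move=> F; case: (F =P G) => [->|nF]; last first.
        by case: ifP => // _; apply: is_cycle0.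
      rewrite rkG eqxx lexx /=; split=> // u; rewrite [u]tuple_eta.
      move: (thead u) [tuple of behead u] => H t.
      rewrite total_chain_cons => /(local_mem_supp xm)[rkH leH].
      rewrite simplex_open_belowE simplex_consE /is_simplex => /and3P[st t0 tH].
      have ltH : (H < G)%O.
        rewrite lt_neqAle leH andbT.
        by apply: contra_eqN rkG => /eqP<-; rewrite rkH; lia.
      rewrite inE -rk_gt0 rkH ltH tH st /=.
      apply/allP => K tK /=; rewrite inE (allP t0) //=.
      exact: lt_trans (allP tH _ tK) ltH.
    exists (fun F => if F == G then total_chain x else 0) => // F.
    rewrite local_delE //; apply/ffunP => t; rewrite phiE sum_ffunE.
    rewrite (bigD1 G) //= eqxx total_chain_cons big1 ?addr0 // => H /negPf->.
    by rewrite ffunE.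
  (* If [rk G <= d + 1], only [G] itself can carry a component, and the vanishing total kills it. *)
  have xH F : F != G -> x F = 0.
    move=> nF; have := xm F; case: ifP => // /andP[/eqP rkF leF].
    have : (F < G)%O by rewrite lt_neqAle nF.
    by move/rk_lt; lia.
  have xG : x G = 0 by rewrite -x0 (bigD1 G) //= big1 ?addr0.
  exists (fun=> 0) => [F|F]; first by case: ifP => // _; apply: is_cycle0.
  rewrite /local_del big1 => [|H _]; last exact: phi0.
  by have [->|/xH->] := eqVneq F G.
Qed.

End LocalComplex.
End RankedPoset.

(** * Labels and completeness *)

Section Labels.
Variables (disp : Order.disp_t) (P : finTBPOrderType disp) (rk : P -> nat).
Hypothesis rk_graded : is_rank_function rk.
Variables (n : nat) (lab : {A : P | atom A} -> 'X_{1..n}).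

Lemma label_leP (F : P) (a : 'X_{1..n}) :
  reflect (forall A, (val A <= F)%O -> (lab A <= a)%MM) (label lab F <= a)%MM.
Proof.
rewrite /label; apply: (iffP idP) => [+ A leA|le_a].
  move=> /mnm_lepP le; apply/mnm_lepP => i; apply: leq_trans (le i).
  rewrite -big_filter; have : A \in [seq B <- index_enum _ | (val B <= F)%O].
    by rewrite mem_filter leA mem_index_enum.
  elim: (filter _ _) => // B s IH; rewrite inE big_cons /mlcm mnmE leq_max.
  by case/orP => [/eqP->|/IH ->]; rewrite ?leqnn ?orbT.
elim/big_ind: _ => [|x y xa ya|A /le_a //]; last by rewrite lem_mlcm xa.
by apply/mnm_lepP => i; rewrite mnm0E.
Qed.

Lemma label_le (F G : P) : (F <= G)%O -> (label lab F <= label lab G)%MM.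
Proof.
move=> FG; apply/label_leP => A AF.
exact: (label_leP _ _ (lepm_refl _)) (le_trans AF FG).
Qed.

Lemma label_atom (A : {A : P | atom A}) : label lab (val A) = lab A.
Proof.
have le1 : (label lab (val A) <= lab A)%MM.
  apply/label_leP => B; rewrite le_eqVlt => /orP[/eqP/val_inj->|].
    exact: lepm_refl.
  move/(rk_lt rk_graded); have := valP A; have := valP B.
  by rewrite /= !(atom_rk rk_graded) => /eqP-> /eqP->.
have le2 := label_leP _ _ (lepm_refl (label lab (val A))) A (lexx _).
apply/mnmP => i; apply/eqP.
by rewrite eqn_leq (mnm_lepP le1) (mnm_lepP le2).
Qed.

Hypothesis P_complete : complete lab.

(** Labels divide along the order, and injectivity excludes equality. *)
Lemma label_lt (F G : P) : (F < G)%O -> exists i, label lab F i < label lab G i.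
Proof.
move=> FG; apply/existsP; apply: contraT => /existsPn ge.
have /P_complete.1 e : label lab F = label lab G.
  apply/mnmP => i; apply/eqP; rewrite eqn_leq (mnm_lepP (label_le (ltW FG))).
  by rewrite leqNgt ge.
by rewrite e ltxx in FG.
Qed.

(** The unique maximal element is a maximum: above any [F] of the set, an element of largest rank in
    the set is maximal, hence equal to [G]. *)
Lemma complete_max (a : 'X_{1..n}) :
  exists G, forall F, (label lab F <= a)%MM = (F <= G)%O.
Proof.
have [G [[Ga Gmax] Guniq]] := P_complete.2 a; exists G => F.
apply/idP/idP => [Fa|/label_le/lepm_trans]; last exact.
pose above H := (F <= H)%O && (label lab H <= a)%MM.
have FF : above F by rewrite /above lexx.
case: (arg_maxnP rk FF) => H /andP[FH Ha] Hmax.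
suff -> : G = H by [].
apply: Guniq; split=> // K Ka HK; apply/eqP; apply: contraT => nKH.
have /(rk_lt rk_graded) : (H < K)%O by rewrite lt_neqAle eq_sym nKH.
by rewrite ltnNge [_ <= _]Hmax // /above (le_trans FH HK).
Qed.

End Labels.

(** * Degree slices and tensoring with a principal monomial ideal *)

Section Slices.
Local Open Scope ring_scope.
Variables (k : fieldType) (n : nat).
Notation S := {mpoly k[n]}.

Lemma mcoeffMX_notin (p : S) (m a : 'X_{1..n}) :
  ~~ (m <= a)%MM -> (p * 'X_[m])@_a = 0.
Proof.
move=> nle; apply/eqP; rewrite mcoeff_eq0 (perm_mem (msuppMX p m)).
by apply: contraNN nle => /mapP[b _ ->]; apply: lem_addr.
Qed.

Lemma homogeneous_of_degreeP (a : 'X_{1..n}) (p : S) :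
  homogeneous_of_degree a p <-> forall b, b != a -> p@_b = 0.
Proof.
split=> [ha b|ha b bp].
  by apply: contraNeq; rewrite -mcoeff_msupp => /ha->.
by apply/eqP; apply: contraTT bp => /ha /eqP; rewrite mcoeff_eq0.
Qed.

Lemma mpoly_family_expansion (T : finType) (f : T -> S) :
  exists B, forall t, f t = \sum_(a : 'X_{1..n < B}) (f t)@_a *: 'X_[a].
Proof.
exists (\max_t msize (f t)) => t; apply: mpolywE.
exact: (leq_bigmax (F := fun t => msize (f t)) t).
Qed.

(** The homogeneous component of degree [a], read over [k] by dropping the factor [x^a]. *)
Definition slice (T : finType) (a : 'X_{1..n}) (c : {ffun T -> S^o}) :
  {ffun T -> k^o} := [ffun t => (c t : S)@_a].

Lemma sliceD (T : finType) (a : 'X_{1..n}) (c c' : {ffun T -> S^o}) :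
  slice a (c + c') = slice a c + slice a c'.
Proof. by apply/ffunP => t; rewrite !ffunE mcoeffD. Qed.

Lemma slice0 (T : finType) (a : 'X_{1..n}) :
  slice a (0 : {ffun T -> S^o}) = 0.
Proof. by apply/ffunP => t; rewrite !ffunE mcoeff0. Qed.

Lemma slice_sum (T : finType) (a : 'X_{1..n}) (I : finType) (Q : pred I)
    (c : I -> {ffun T -> S^o}) :
  slice a (\sum_(i | Q i) c i) = \sum_(i | Q i) slice a (c i).
Proof. by apply: big_morph; [apply: sliceD | apply: slice0]. Qed.

Lemma slice_inj (T : finType) (c c' : {ffun T -> S^o}) :
  (forall a, slice a c = slice a c') -> c = c'.
Proof.
move=> e; apply/ffunP => t; apply/mpolyP => a.
by have /ffunP/(_ t) := e a; rewrite !ffunE.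
Qed.

Section Tensor.
Variables (T : finType) (Z : {ffun T -> k^o} -> Prop) (m : 'X_{1..n}).
Hypothesis Z0 : Z 0.
Hypothesis ZP : forall a u v, Z u -> Z v -> Z (a *: u + v).

(** In degree [a] the ideal generated by [x^m] is a copy of [k] if [m <= a] and zero otherwise, so
    membership can be tested degree by degree. *)
Lemma tensor_monomial_slices (c : {ffun T -> S^o}) :
  tensor_monomial Z m c <->
  forall a, if (m <= a)%MM then Z (slice a c) else slice a c = 0.
Proof.
split=> [[N [z [q [Zz ->]]]] a|Zc].
  have -> : slice a (\sum_j [ffun t => (z j t)%:MP * (q j * 'X_[m])])
      = \sum_j (q j * 'X_[m])@_a *: z j.
    rewrite slice_sum; apply: eq_bigr => j _; apply/ffunP => t.
    by rewrite !ffunE mcoeffCM mulrC.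
  case: ifPn => [_|nle]; last first.
    by rewrite big1 // => j _; rewrite mcoeffMX_notin ?scale0r.
  elim/big_ind: _ => // [u v Zu Zv|j _].
    by rewrite -[u]scale1r; apply: ZP.
  by rewrite -[_ *: _]addr0; apply: ZP.
have [B eB] := mpoly_family_expansion (fun t => c t : S).
pose I : finType := 'X_{1..n < B}.
(* One pure tensor per exponent [a] below the size bound. The slice is replaced by zero unless
   [m <= a], so the truncated difference [a - m] does no harm. *)
exists #|I|, (fun j => let a := val (enum_val j : I) in
                if (m <= a)%MM then slice a c else 0),
  (fun j => 'X_[val (enum_val j : I) - m]); split=> [j /=|].
  by have := Zc (val (enum_val j : I)); case: ifP.
pose g (a : I) : {ffun T -> S^o} :=
  [ffun t => ((if (m <= val a)%MM then slice (val a) c else 0) t)%:MP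
             * ('X_[val a - m] * 'X_[m])].
rewrite -(big_enum_val g) /=; apply/ffunP => t.
rewrite sum_ffunE [LHS]eB; apply: eq_big => [a|a _]; first by rewrite inE.
rewrite !ffunE -mpolyXD; have := Zc (val a); case: ifP => [le _|_ /ffunP/(_ t)].
  by rewrite submK // ffunE mul_mpolyC.
by rewrite !ffunE => ->; rewrite scale0r mpolyC0 mul0r.
Qed.

End Tensor.
End Slices.

(** * Cycles as a finite-dimensional vector space *)

Section CycleSpace.
Local Open Scope ring_scope.
Variables (disp : Order.disp_t) (P : finPOrderType disp) (k : fieldType).

(** Its kernel consists of the chains supported on simplices of [V], so the cycles become an
    intersection of kernels and acquire a basis. *)
Definition off_simplices (V : {set P}) s (c : {ffun s.-tuple P -> k^o}) :
    {ffun s.-tuple P -> k^o} :=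
  [ffun t => if is_simplex V t then 0 else c t].

Lemma off_simplices_linear V s : linear (@off_simplices V s).
Proof.
move=> a c c'; apply/ffunP => t; rewrite !ffunE.
by case: ifP => // _; rewrite scaler0 addr0.
Qed.
HB.instance Definition _ V s := GRing.isLinear.Build k _ _ _
  (@off_simplices V s) (@off_simplices_linear V s).

Definition cycle_space (V : {set P}) s : {vspace {ffun s.-tuple P -> k^o}} :=
  (lker (linfun (@boundary _ P k s)) :&: lker (linfun (@off_simplices V s)))%VS.

Lemma cycle_spaceP V s c : reflect (is_cycle V c) (c \in cycle_space V s).
Proof.
rewrite memv_cap !memv_ker !lfunE.
apply: (iffP andP) => [[/eqP b0 /eqP/ffunP c0]|[cV b0]]; split=> //.
- move=> t; apply: contraNT => /negPf nt.
  by have := c0 t; rewrite !ffunE nt => ->.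
- exact/eqP.
apply/eqP/ffunP => t; rewrite !ffunE; case: ifPn => // nt.
by apply/eqP; apply: contraNT nt => /cV.
Qed.

End CycleSpace.

(** Transport along an enumeration: the basis of C(P) is naturally indexed by pairs of a poset
    element and a basis index. *)
Lemma graded_free_fin (k : fieldType) (n : nat) (M : gmodule k n) (I : finType)
    (b : I -> M) (e : I -> 'X_{1..n}) :
  (forall v,
     gmem v <-> exists p : I -> {mpoly k[n]}, v = \sum_i p i *: b i)%R ->
  (forall p : I -> {mpoly k[n]},
     \sum_i p i *: b i = 0 -> forall i, p i = 0)%R ->
  (forall a v, gcomp a v <->
     exists2 p : I -> {mpoly k[n]},
       forall i c, c \in msupp (p i) -> (e i + c)%MM = a
       & v = (\sum_i p i *: b i)%R) ->
  graded_free M.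
Proof.
move=> bmem bfree bcomp.
have toI (p : 'I_#|I| -> {mpoly k[n]}) :
    (\sum_j p j *: b (enum_val j) = \sum_i p (enum_rank i) *: b i)%R.
  rewrite (reindex (@enum_rank I)) /=; last exact/onW_bij/enum_rank_bij.
  by apply: eq_bigr => i _; rewrite enum_rankK.
have fromI (p : I -> {mpoly k[n]}) :
    (\sum_i p i *: b i = \sum_(j < #|I|) p (enum_val j) *: b (enum_val j))%R.
  rewrite [RHS](toI (p \o enum_val)).
  by apply: eq_bigr => i _; rewrite /= enum_rankK.
exists #|I|, (b \o enum_val), (e \o enum_val); split=> [v|p|a v] /=.
- split=> [/bmem[p ->]|[p ->]]; last by apply/bmem; rewrite toI; eexists.
  by exists (p \o enum_val); rewrite fromI.
- by rewrite toI => /bfree p0 j; rewrite -[j]enum_valK.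
split=> [/bcomp[p pa ->]|[p pa ->]].
  by exists (p \o enum_val) => [j|]; [apply: pa | rewrite fromI].
apply/bcomp; exists (p \o enum_rank) => [i c|]; last exact: toI.
by rewrite -{2}[i]enum_rankK; apply: pa.
Qed.

(** * Differential, exactness and minimality of C(P) *)

Section Resolution.
Local Open Scope ring_scope.
Variables (k : fieldType) (n : nat).
Variables (disp : Order.disp_t) (P : finTBPOrderType disp).
Variables (rk : P -> nat) (lab : {A : P | atom A} -> 'X_{1..n}).
Hypothesis rk_graded : is_rank_function rk.
Hypothesis P_complete : complete lab.
Notation S := {mpoly k[n]}.
Notation C := (poset_module k rk lab).

Lemma slice_phi s (a : 'X_{1..n}) F (c : {ffun s.+1.-tuple P -> S^o}) :
  slice a (phi F c) = phi F (slice a c).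
Proof. by apply/ffunP => t; rewrite !(ffunE, phiE). Qed.

Lemma slice_del d (a : 'X_{1..n}) (c : C d.+1) F :
  slice a (poset_del c F) = local_del rk (fun F => slice a (c F)) F.
Proof.
rewrite ffunE slice_sum; apply: eq_bigr => G _; exact: slice_phi.
Qed.

(** With [G] the largest element of label at most [a], divisibility of [x^a] by [m_F] reads
    [F <= G], so each slice lies in a local complex. *)
Lemma poset_mem_slices d (c : C d) :
  gmem c <-> forall a G, (forall F, (label lab F <= a)%MM = (F <= G)%O) ->
             local_mem rk G (fun F => slice a (c F)).
Proof.
have tens F := @tensor_monomial_slices k n _ (@is_cycle _ P k (open_below F) d)
  (label lab F) (@is_cycle0 _ P k (open_below F) d)
  (@is_cycle_linear _ P k (open_below F) d) (c F).
split=> [cm a G aG F|cm F].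
  have := cm F; case: eqP => /= [_|_ ->]; last exact: slice0.
  by move=> /tens/(_ a); rewrite aG.
case: ifPn => [rkF|rkF]; last first.
  apply: slice_inj => a; have [G aG] := complete_max rk_graded P_complete a.
  by have := cm a G aG F; rewrite (negPf rkF) /= slice0.
apply/tens => a; have [G aG] := complete_max rk_graded P_complete a.
by have := cm a G aG F; rewrite rkF aG.
Qed.

Lemma poset_mem0 d : gmem (0 : C d).
Proof.
apply/poset_mem_slices => a G _ F; rewrite ffunE slice0.
by case: ifP => // _; apply: is_cycle0.
Qed.

Lemma poset_memD d (c c' : C d) : gmem c -> gmem c' -> gmem (c + c').
Proof.
move=> /poset_mem_slices cm /poset_mem_slices cm'; apply/poset_mem_slices.
move=> a G aG F; have := cm a G aG F; have := cm' a G aG F.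
rewrite ffunE sliceD; case: ifP => [_ zc zc'|_ -> ->]; last by rewrite addr0.
by rewrite -[slice a (c F)]scale1r; apply: is_cycle_linear.
Qed.

Definition pure_tensor d (a : 'X_{1..n}) (x : P -> {ffun d.-tuple P -> k^o}) :
    C d :=
  [ffun F => [ffun t => x F t *: ('X_[a] : S)]].

Lemma slice_pure_tensor d a b (x : P -> {ffun d.-tuple P -> k^o}) F :
  slice b (pure_tensor a x F) = if a == b then x F else 0.
Proof.
apply/ffunP => t; rewrite !ffunE mcoeffZ mcoeffX.
by case: eqP => _; rewrite ?mulr1 ?mulr0 ?ffunE.
Qed.

Lemma pure_tensor_mem d a G (x : P -> {ffun d.-tuple P -> k^o}) :
  (forall F, (label lab F <= a)%MM = (F <= G)%O) -> local_mem rk G x ->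
  gmem (pure_tensor a x).
Proof.
move=> aG xm; apply/poset_mem_slices => b H bH F; rewrite slice_pure_tensor.
case: (a =P b) => [e|_]; last by case: ifP => // _; apply: is_cycle0.
by rewrite -bH -e aG; apply: xm.
Qed.

Lemma poset_chain_expansion d (c : C d) :
  exists B, c = \sum_(a : 'X_{1..n < B})
    pure_tensor (val a) (fun F => slice (val a) (c F)).
Proof.
have [B eB] := mpoly_family_expansion
  (fun p : P * d.-tuple P => c p.1 p.2 : S).
exists B; apply/ffunP => F; apply/ffunP => t; rewrite !sum_ffunE.
rewrite [LHS](eB (F, t)); apply: eq_bigr => a _; by rewrite !ffunE.
Qed.

Lemma poset_delE d (c : C d.+1) F (t : d.-tuple P) :
  poset_del c F t = \sum_(G | rk G == (rk F).+1) c G [tuple of F :: t].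
Proof. by rewrite ffunE sum_ffunE; apply: eq_bigr => G _; rewrite phiE. Qed.

Lemma poset_scaleE d (p : S) (c c' : C d) F t :
  (p *: c + c') F t = p * c F t + c' F t :> S.
Proof. by rewrite 4!ffunE. Qed.

Lemma poset_del_linear d (p : S) (c c' : C d.+1) :
  poset_del (p *: c + c') = p *: poset_del c + poset_del c'.
Proof.
apply/ffunP => F; apply/ffunP => t.
rewrite [LHS]poset_delE [RHS](poset_scaleE p (poset_del c) (poset_del c')).
rewrite [X in p * X + _](poset_delE c F t).
rewrite [X in _ = _ + X](poset_delE c' F t).
rewrite mulr_sumr -big_split; apply: eq_bigr => G _; exact: poset_scaleE.
Qed.

Lemma poset_del0 d : poset_del (0 : C d.+1) = 0.
Proof.
have := poset_del_linear (-1) 0 (0 : C d.+1).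
by rewrite scaler0 addr0 scaleN1r addNr.
Qed.

Lemma poset_delD d (c c' : C d.+1) :
  poset_del (c + c') = poset_del c + poset_del c'.
Proof. by have := poset_del_linear 1 c c'; rewrite !scale1r. Qed.

Lemma poset_del_mem d (c : C d.+1) : gmem c -> gmem (poset_del c).
Proof.
move=> /poset_mem_slices cm; apply/poset_mem_slices => a G aG F.
by rewrite slice_del; apply: (local_del_mem rk_graded (cm a G aG)).
Qed.

Lemma poset_del_total d (w : C d.+1) a :
  gmem w -> \sum_F slice a (poset_del w F) = 0.
Proof.
move=> /poset_mem_slices wm; have [G aG] := complete_max rk_graded P_complete a.
under eq_bigr do rewrite slice_del.
exact: (local_total_del rk_graded (wm a G aG)).
Qed.

(** Stated through totals so that one exactness argument serves both this kernel and that of the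
    augmentation. *)
Lemma poset_del_eq0 d (v : C d.+1) :
  gmem v -> poset_del v = 0 <-> forall a, \sum_F slice a (v F) = 0.
Proof.
move=> /poset_mem_slices vm; split=> [dv a|tv].
  have [G aG] := complete_max rk_graded P_complete a.
  apply/(local_del_total0 rk_graded (vm a G aG)) => F.
  by rewrite -slice_del dv ffunE slice0.
apply/ffunP => F; rewrite [RHS]ffunE; apply: slice_inj => a; rewrite slice0.
have [G aG] := complete_max rk_graded P_complete a; rewrite slice_del.
by move: F; apply/(local_del_total0 rk_graded (vm a G aG)).
Qed.

(** Chains here live on the empty tuple alone, so the total of a slice has a single entry, the
    coefficient of the augmentation. *)
Lemma poset_aug_eq0 (v : C 0) :
  gmem v -> poset_aug v = 0 <-> forall a, \sum_F slice a (v F) = 0.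
Proof.
move=> vm.
have sl a : (\sum_F slice a (v F)) [tuple] = (poset_aug v : S)@_a.
  rewrite sum_ffunE raddf_sum [RHS]big_mkcond; apply: eq_bigr => F _.
  rewrite ffunE (atom_rk rk_graded); have := vm F.
  by case: ifP => // _ ->; rewrite ffunE mcoeff0.
split=> [v0 a|v0]; last by apply/mpolyP => a; rewrite -sl v0 ffunE mcoeff0.
by apply/ffunP => t; rewrite (tuple0 t) sl v0 mcoeff0 ffunE.
Qed.

Lemma poset_exact d (v : C d) :
  (forall G : P, (d + 3 <= rk G)%N ->
     reduced_homology_vanishes k (truncation_proper_part rk G (d + 3)) d) ->
  gmem v -> (forall a, \sum_F slice a (v F) = 0) ->
  exists2 w : C d.+1, gmem w & poset_del w = v.
Proof.
move=> hom /poset_mem_slices vm v0.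
(* Each of the finitely many homogeneous parts is lifted separately; liftable elements are closed
   under sums. *)
have [B ->] := poset_chain_expansion v.
elim/big_ind: _ => [|_ _ [w wm <-] [w' wm' <-]|a _].
- by exists 0; [apply: poset_mem0 | apply: poset_del0].
- by exists (w + w'); [apply: poset_memD | apply: poset_delD].
have [G aG] := complete_max rk_graded P_complete (val a).
have [w wm dw] := local_exact rk_graded (hom G) (vm _ G aG) (v0 _).
exists (pure_tensor (val a) w); first exact: pure_tensor_mem wm.
apply/ffunP => F; apply: slice_inj => b.
rewrite slice_del slice_pure_tensor -dw.
rewrite /local_del; case: eqP => [->|/eqP/negPf ne].
  by apply: eq_bigr => H _; rewrite slice_pure_tensor eqxx.
by apply: big1 => H _; rewrite slice_pure_tensor ne phi0.
Qed.

Lemma poset_del_hom d : graded_hom (@poset_del k n disp P rk lab d).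
Proof.
split=> [v|p v w _ _|a v [vm va]]; first exact: poset_del_mem.
  exact: poset_del_linear.
split=> [|F t]; first exact: poset_del_mem.
apply/homogeneous_of_degreeP => b ba.
suff /ffunP/(_ t) : slice b (poset_del v F) = 0 by rewrite !ffunE.
rewrite slice_del /local_del big1 // => G _.
suff -> : slice b (v G) = 0 by rewrite phi0.
apply/ffunP => u; rewrite !ffunE.
by have /homogeneous_of_degreeP := va G u; apply.
Qed.

Lemma poset_aug_hom : graded_hom (@poset_aug k n disp P rk lab).
Proof.
split=> // [p v w _ _|a v [vm va]].
  rewrite /poset_aug scaler_sumr -big_split; apply: eq_bigr => A _.
  by rewrite !ffunE.
apply/homogeneous_of_degreeP => b ba; rewrite raddf_sum big1 // => A _.
by have /homogeneous_of_degreeP := va A [tuple]; apply.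
Qed.

(** For an atom [A] the cycles on the empty chain are all of [k], so its summand maps onto the ideal
    generated by [x^(lab A)]. *)
Lemma poset_aug_image (p : S) :
  poset_ideal lab p <-> exists2 v : C 0, gmem v & poset_aug v = p.
Proof.
have sumA (f : P -> S) :
    \sum_(F | atom F) f F = \sum_(A : {A : P | atom A}) f (val A).
  exact: (big_sub (fun F => atom F)).
split=> [[q ->]|[v vm <-]].
  exists [ffun F => [ffun _ => oapp (fun A => q A * 'X_[lab A]) 0 (insub F)]].
    move=> F; rewrite ffunE -(atom_rk rk_graded); case: ifPn => [atF|nF].
      rewrite insubT /=; exists 1%N, (fun=> [ffun=> 1]), (fun=> q (Sub F atF)).
      split=> [_|].
        split; last exact: boundary_empty.
        by move=> t _; rewrite (tuple0 t).
      apply/ffunP => t; rewrite big_ord1 !ffunE mul1r.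
      by rewrite -(label_atom rk_graded lab (Sub F atF)).
    by rewrite insubN //; apply/ffunP => t; rewrite !ffunE.
  rewrite /poset_aug sumA; apply: eq_bigr => A _.
  by rewrite !ffunE valK.
have /fin_all_exists[q vq] : forall A : {A : P | atom A}, exists q : S,
    v (val A) [tuple] = q * 'X_[lab A].
  move=> A; have := vm (val A); rewrite -(atom_rk rk_graded) (valP A).
  case=> N [z [q [_ ->]]]; exists (\sum_j (z j [tuple])%:MP * q j).
  rewrite sum_ffunE mulr_suml; apply: eq_bigr => j _.
  by rewrite ffunE (label_atom rk_graded) mulrA.
by exists q; rewrite /poset_aug sumA; apply: eq_bigr => A _.
Qed.

(** Split the image into parts with one degree [a] and one component [F']. A nonzero part comes from
    some [F > F'] with [m_F] dividing [x^a], so a variable can be divided out while [m_F'] still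
    divides the rest. *)
Lemma poset_minimal d (v : C d.+1) :
  gmem v -> in_maximal_ideal_mul (poset_del v).
Proof.
move=> vm; have /poset_mem_slices vs := vm; have dm := poset_del_mem vm.
have /poset_mem_slices dms := dm.
have [B ->] := poset_chain_expansion (poset_del v).
have mulD (u u' : C d) : in_maximal_ideal_mul u -> in_maximal_ideal_mul u' ->
    in_maximal_ideal_mul (u + u').
  move=> [w wm ->] [w' wm' ->]; exists (fun i => w i + w' i) => [i|].
    exact: poset_memD.
  by rewrite -big_split; apply: eq_bigr => i _; rewrite scalerDr.
have mul0 : in_maximal_ideal_mul (0 : C d).
  exists (fun=> 0) => [i|]; first exact: poset_mem0.
  by rewrite big1 // => i _; rewrite scaler0.
elim/big_ind: _ => // a _.
have [G aG] := complete_max rk_graded P_complete (val a).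
pose part F' F := if F == F' then slice (val a) (poset_del v F) else 0.
have -> : pure_tensor (val a) (fun F => slice (val a) (poset_del v F))
  = \sum_F' pure_tensor (val a) (part F').
  apply/ffunP => F; apply/ffunP => t; rewrite !sum_ffunE (bigD1 F) //= big1.
    by rewrite !ffunE /part eqxx addr0 !ffunE.
  by move=> F' nF; rewrite !ffunE /part eq_sym (negPf nF) ffunE scale0r.
elim/big_ind: _ => // F' _.
have [z|nz] := eqVneq (slice (val a) (poset_del v F')) 0.
  suff -> : pure_tensor (val a) (part F') = 0.
    exact: mul0.
  apply/ffunP => F; apply: slice_inj => b.
  rewrite slice_pure_tensor [in RHS]ffunE slice0 /part.
  case: (F =P F') => [->|_].
    by rewrite z if_same.
  by rewrite if_same.
have [F [ltF leF]] : exists F, (F' < F)%O /\ (F <= G)%O.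
  move: nz; rewrite slice_del (local_delE rk_graded _ (vs _ G aG)) => nz.
  have [F /negP/negP nzF] : exists F, ~~ (phi F' (slice (val a) (v F)) == 0).
    apply/existsP; apply: contraNT nz => /existsPn z; apply/eqP/ffunP => t.
    rewrite phiE sum_ffunE [RHS]ffunE big1 // => F _.
    by have := z F; rewrite negbK => /eqP/ffunP/(_ t); rewrite phiE [RHS]ffunE.
  have [t nzt] : exists t, phi F' (slice (val a) (v F)) t != 0.
    apply/existsP; apply: contraNT nzF => /existsPn z; apply/eqP/ffunP => t.
    by have := z t; rewrite negbK [RHS]ffunE => /eqP.
  move: nzt; rewrite phiE => /(local_mem_supp_cons rk_graded (vs _ G aG)).
  by case=> _ leF ltF _ _; exists F.
(* At [i] the label of [F'] is smaller than that of [F], hence than [a], so lowering [a] by one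
   there keeps it above the label of [F']. *)
have [i lti] := label_lt P_complete ltF.
have lea : (label lab F <= val a)%MM by rewrite aG.
have ai : (U_(i) <= val a)%MM.
  rewrite lep1mP -lt0n; apply: leq_trans (mnm_lepP lea i).
  exact: leq_ltn_trans lti.
have lea' : (label lab F' <= val a - U_(i))%MM.
  apply/mnm_lepP => j; rewrite mnmBE mnm1E.
  have := mnm_lepP (label_le lab (ltW ltF)) j; have := mnm_lepP lea j.
  by case: eqP => [<-|_] /=; [move: lti|]; lia.
have [H bH] := complete_max rk_graded P_complete (val a - U_(i))%MM.
(* Only the chosen variable gets a nonzero cofactor: the same part, one degree lower. *)
exists (fun j => if j == i then pure_tensor (val a - U_(i))%MM (part F')
                  else 0).
  move=> j; case: eqP => _; last exact: poset_mem0.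
  apply: (pure_tensor_mem bH) => K; rewrite /part.
  case: (K =P F') => [->|_]; last first.
    by case: ifP => // _; apply: is_cycle0.
  have := dms (val a) G aG F'; rewrite -bH lea' -aG.
  by rewrite (lepm_trans (label_le lab (ltW ltF)) lea).
rewrite (bigD1 i) //= eqxx [X in _ + X]big1 ?addr0; last first.
  by move=> j /negPf->; rewrite scaler0.
apply/ffunP => K; apply/ffunP => t; rewrite !ffunE.
have scaleX (x : k) : ('X_i : S) *: (x *: 'X_[val a - U_(i)] : S^o)
    = x *: 'X_[val a].
  rewrite -[in RHS](submK ai) mpolyXD mulrC; by rewrite scalerAr.
by rewrite [RHS]scaleX.
Qed.

End Resolution.

(** * A homogeneous basis in each homological degree *)

Section Freeness.
Local Open Scope ring_scope.
Variables (k : fieldType) (n : nat).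
Variables (disp : Order.disp_t) (P : finTBPOrderType disp).
Variables (rk : P -> nat) (lab : {A : P | atom A} -> 'X_{1..n}).
Variable d : nat.
Notation S := {mpoly k[n]}.
Notation C := (poset_module k rk lab d).

(** The zero space in other ranks lets the basis be indexed over all of [P]. *)
Let U (F : P) : {vspace {ffun d.-tuple P -> k^o}} :=
  if rk F == d.+1 then cycle_space k (open_below F) d else 0%VS.
Let I : finType := {F : P & 'I_(\dim (U F))}.
Let eb (F : P) (i : 'I_(\dim (U F))) : {ffun d.-tuple P -> k^o} :=
  (vbasis (U F))`_i.
Let tg (F : P) (i : 'I_(\dim (U F))) : I := Tagged _ i.
Let b (x : I) : C :=
  [ffun F => if F == tag x
             then [ffun t => (eb (tagged x) t)%:MP * 'X_[label lab F]] else 0].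

Let combE (p : I -> S) F :
  (\sum_x p x *: b x) F
  = \sum_(i < \dim (U F)) [ffun t => (eb i t)%:MP
              * (p (tg i) * 'X_[label lab F])].
Proof.
rewrite sum_ffunE.
transitivity (\sum_G \sum_(i < \dim (U G)) (p (tg i) *: b (tg i)) F).
  by rewrite [RHS]sig_big_dep; apply: eq_bigr => -[G i] _.
rewrite (bigD1 F) //= [X in _ + X]big1 ?addr0 => [|G nG]; last first.
  by apply: big1 => i _; rewrite !ffunE eq_sym (negPf nG) scaler0.
apply: eq_bigr => i _; rewrite !ffunE eqxx; apply/ffunP => t.
by rewrite !ffunE mulrCA.
Qed.

(** Degrees shifted by [m_F] isolate single coefficients of [p], which reduces independence over
    [k[x]] to independence over [k]. *)
Let slice_comb (p : I -> S) F (c : 'X_{1..n}) :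
  slice (label lab F + c)%MM ((\sum_x p x *: b x) F)
  = \sum_(i < \dim (U F)) (p (tg i))@_c *: eb i.
Proof.
rewrite combE slice_sum; apply: eq_bigr => i _; apply/ffunP => t.
by rewrite !ffunE mcoeffCM mcoeffMX mulrC.
Qed.

Let coef0 (p : I -> S) F c :
  slice (label lab F + c)%MM ((\sum_x p x *: b x) F) = 0 ->
  forall i : 'I_(\dim (U F)), (p (tg i))@_c = 0.
Proof. by rewrite slice_comb; apply/freeP/(basis_free (vbasisP _)). Qed.

Let ebU F i : @eb F i \in U F.
Proof. by apply/vbasis_mem/mem_nth; rewrite size_tuple. Qed.

Let comb_mem (p : I -> S) : gmem (\sum_x p x *: b x : C).
Proof.
move=> F; rewrite combE; case: ifP => rkF; last first.
  apply: big1 => i _; have := ebU i; rewrite /U rkF memv0 => /eqP e.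
  by apply/ffunP => t; rewrite !ffunE e ffunE mpolyC0 mul0r.
exists (\dim (U F)), (@eb F),
  (fun i => p (tg i)); split=> // i.
apply/cycle_spaceP; suff <- : U F = cycle_space k (open_below F) d by [].
by rewrite /U rkF.
Qed.

Let mem_comb (v : C) : gmem v -> exists p : I -> S, v = \sum_x p x *: b x.
Proof.
move=> vm.
suff /fin_all_exists[p vp] : forall F, exists p : 'I_(\dim (U F)) -> S,
    v F = \sum_i [ffun t => (eb i t)%:MP * (p i * 'X_[label lab F])].
  by exists (fun x => p (tag x) (tagged x)); apply/ffunP => F; rewrite combE.
move=> F; have := vm F; case: ifP => rkF; last first.
  move=> ->; exists (fun=> 0); rewrite big1 // => i _.
  by apply/ffunP => t; rewrite !ffunE mul0r mulr0.
case=> N [z [q [zc ->]]].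
(* Expand each [z j] in the chosen basis and collect the polynomial coefficients. *)
exists (fun i => \sum_j (coord (vbasis (U F)) i (z j))%:MP * q j).
apply/ffunP => t; rewrite !sum_ffunE.
under [RHS]eq_bigr do rewrite ffunE mulr_suml mulr_sumr.
rewrite exchange_big; apply: eq_bigr => j _; rewrite ffunE.
have zU : z j \in U F by rewrite /U rkF; apply/cycle_spaceP.
rewrite {1}(coord_vbasis zU) sum_ffunE raddf_sum mulr_suml.
apply: eq_bigr => i _.
have -> : (coord (vbasis (U F)) i (z j) *: (vbasis (U F))`_i) t
    = coord (vbasis (U F)) i (z j) * eb i t by rewrite ffunE.
rewrite [X in X * _ = _]mpolyCM !mulrA; congr (_ * _ * _); exact: mulrC.
Qed.

Lemma poset_graded_free : graded_free C.
Proof.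
apply: (@graded_free_fin k n C I b (fun x => label lab (tag x))).
- by move=> v; split=> [/mem_comb //|[p ->]].
- move=> p p0 [F i]; apply/mpolyP => c; rewrite mcoeff0.
  by apply: coef0; rewrite p0 ffunE slice0.
move=> a v; split=> [[vm va]|[p pa ->]].
  (* If [m_F * x^c] has degree other than [a], that slice of [v] vanishes, and with it the
     coefficient of [x^c] in [p]. *)
  have [p vp] := mem_comb vm; exists p => // -[F i] c /=.
  rewrite mcoeff_msupp; apply: contraNeq => ne; apply/eqP; apply: coef0.
  apply/ffunP => t; rewrite -vp !ffunE.
  by have /homogeneous_of_degreeP := va F t; apply.
split=> [|F t]; first exact: comb_mem.
apply/homogeneous_of_degreeP => c ca.
rewrite combE sum_ffunE raddf_sum big1 // => i _; rewrite ffunE [LHS]mcoeffCM.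
have [le|nle] := boolP (label lab F <= c)%MM; last first.
  by rewrite mcoeffMX_notin ?mulr0.
rewrite -(submK le) addmC mcoeffMX; apply/eqP; rewrite mulf_eq0.
apply/orP; right.
apply: contraNT ca; rewrite -mcoeff_msupp => /pa /= <-.
by rewrite addmC submK.
Qed.

End Freeness.

Theorem theorem3p9 (k : fieldType) (n : nat)
    (disp : Order.disp_t) (P : finTBPOrderType disp)
    (rk : P -> nat) (r : nat) (lab : {A : P | atom A} -> 'X_{1..n})
    (rk_graded : is_rank_function rk) (rk_top : rk \top%O = r)
    (P_complete : complete lab)
    (P_homology : forall (i : nat) (F : P),
       i + 3 <= r -> i + 3 <= rk F ->
       reduced_homology_vanishes k (truncation_proper_part rk F (i + 3)) i) :
  minimal_graded_free_resolution
    (@poset_del k n disp P rk lab) (@poset_aug k n disp P rk lab)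
    (@poset_ideal disp P n lab k).
Proof.
(* The side condition on [r] holds because the top element has the largest rank. *)
have hom d (G : P) : d + 3 <= rk G ->
    reduced_homology_vanishes k (truncation_proper_part rk G (d + 3)) d.
  move=> le; apply: P_homology => //; apply: leq_trans le _.
  by rewrite -rk_top (rk_le rk_graded) ?lex1.
split.
- by move=> d; apply: poset_graded_free.
- by split=> [d|]; [apply: poset_del_hom | apply: poset_aug_hom].
(* Both kernels are rewritten as vanishing totals: images have zero total, and [poset_exact] gives
   the converse. *)
- split=> [d v vm|v vm].
    rewrite (poset_del_eq0 rk_graded P_complete vm).
    split=> [|[w wm <-] a]; last exact: (poset_del_total rk_graded).
    exact: (poset_exact rk_graded P_complete (hom _) vm).
  rewrite (poset_aug_eq0 rk_graded vm).
  split=> [|[w wm <-] a]; last exact: (poset_del_total rk_graded).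
  exact: (poset_exact rk_graded P_complete (hom _) vm).
- by move=> p; apply: poset_aug_image.
by move=> d v; apply: poset_minimal.
Qed.
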